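(* If $f(x_1,\ldots,x_n)\in\mathrm{QSym}_n$ is homogeneous of degree $k$, then $$f(x_1,\ldots,x_n)=\sum_{\mathbf{a}=(a_1,\ldots,a_k)\in\mathrm{QSeq}_n}(\mathsf{T}_{\mathbf{a}}f)\,\mathfrak{F}_{\mathbf{a}},$$ where the sum is over the elements of $\mathrm{QSeq}_n$ of length $k$, and $\mathsf{T}_{\mathbf{a}}=\mathsf{T}_{a_k}\cdots\mathsf{T}_{a_1}$ denotes the reverse composition for $\mathbf{a}=(a_1,\ldots,a_k)$ (so $\mathsf{T}_{a_1}$ is applied first).
   Context: $\mathrm{Pol}=\mathbb{Z}[x_1,x_2,\ldots]$, $\mathrm{Pol}_n=\mathbb{Z}[x_1,\ldots,x_n]$. $\mathrm{QSym}_n\subset \mathrm{Pol}_n$ is the set of polynomials such that for every sequence $a_1,\ldots,a_k\ge 1$ the coefficients of $x_{i_1}^{a_1}\cdots x_{i_k}^{a_k}$ and $x_{j_1}^{a_1}\cdots x_{j_k}^{a_k}$ are equal whenever $1\le i_1<\cdots<i_k\le n$ and $1\le j_1<\cdots<j_k\le n$. For $i\ge 1$, $\mathsf{R}_i(f)=f(x_1,\ldots,x_{i-1},0,x_i,x_{i+1},\ldots)$ and $\mathsf{T}_i(f)=\frac{\mathsf{R}_{i+1}(f)-\mathsf{R}_i(f)}{x_i}$ for $f\in\mathrm{Pol}$. $\mathrm{QSeq}_n$ is the set of finite sequences $(a_1,\ldots,a_k)$ of positive integers with $a_1=n$ and $a_i-a_{i+1}\in\{0,1\}$ for $1\le i\le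 k-1$; the empty sequence is included. For a sequence $a=(a_1,\ldots,a_k)$ of positive integers, let $\mathcal{C}(a)$ be the set of sequences $(i_1,\ldots,i_k)$ of positive integers with $i_j\le a_j$ for all $j$, $i_j\ge i_{j+1}$ for all $1\le j<k$, and $i_j>i_{j+1}$ whenever $a_j>a_{j+1}$. The slide polynomial is $\mathfrak{F}_a=\sum_{(i_1,\ldots,i_k)\in\mathcal{C}(a)}x_{i_1}\cdots x_{i_k}$ (equal to $1$ for the empty sequence). *)

(* Defs.v *)
From HB Require Import structures.
From mathcomp Require Import all_boot all_algebra finmap.
From mathcomp.multinomials Require Import monalg.

Set Implicit Arguments.
Unset Strict Implicit.
Unset Printing Implicit Defensive.

Import GRing.Theory.

Local Open Scope ring_scope.

(* Z[x_1, x_2, ...]. The library's variables are indexed from 0, so the        *)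
(* mathematical variable x_i (i >= 1) is the library variable i.-1, and the    *)
(* exponent of x_i in the monomial m is m i.-1. All definitions below take the *)
(* mathematical, 1-based, index; they are only meaningful for indices >= 1.    *)
Definition Pol := {malg int[{cmonom nat}]}.

Definition x (i : nat) : Pol := << ucm i.-1 >>.

Definition inPol (n : nat) (f : Pol) : Prop :=
  forall m, m \in msupp f -> forall i, (n < i)%N -> m i.-1 = 0%N.

(* x_{i_1}^{a_1} ... x_{i_k}^{a_k} for i = (i_1, ..., i_k), a = (a_1, ..., a_k) *)
Definition mon (i a : seq nat) : {cmonom nat} :=
  \big[mmul/mone]_(p <- zip i a) expcmn (ucm p.1.-1) p.2.

Definition incr_in (n : nat) (i : seq nat) : bool :=
  sorted ltn i && all (fun p => 1 <= p <= n)%N i.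

Definition inQSym (n : nat) (f : Pol) : Prop :=
  inPol n f /\
  forall a i j : seq nat,
    all (leq 1) a -> size i = size a -> size j = size a ->
    incr_in n i -> incr_in n j ->
    f@_(mon i a) = f@_(mon j a).

Definition homogeneous (k : nat) (f : Pol) : Prop :=
  forall m, m \in msupp f -> mdeg m = k.

(* f(g_1, g_2, ...) *)
Definition subst (g : nat -> Pol) (f : Pol) : Pol :=
  mmap (fun c : int => c%:MP)
       (fun m : {cmonom nat} => \prod_(v <- finsupp m) g v.+1 ^+ m v) f.

Definition R (i : nat) (f : Pol) : Pol :=
  subst (fun j => if (j < i)%N then x j
                  else if j == i then 0 else x j.-1) f.

(* Quotient in the Euclidean division of f by x_i (monomials not divisible by  *)
(* x_i are dropped). In T the division is exact: see mulx_T.                   *)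
Definition divx (i : nat) (f : Pol) : Pol :=
  \sum_(m <- msupp f | (0 < m i.-1)%N) << f@_m *g divcm m (ucm i.-1) >>.

Definition T (i : nat) (f : Pol) : Pol := divx i (R i.+1 f - R i f).

(* T_{a_k} ( ... (T_{a_1} f)) *)
Definition Tseq (a : seq nat) (f : Pol) : Pol := foldl (fun g i => T i g) f a.

Definition QSeq (n : nat) (a : seq nat) : bool :=
  [&& all (leq 1) a, (a == [::]) || (head 0%N a == n)
    & sorted (fun p q => (p == q) || (p == q.+1)) a].

(* i \in C(a); all2 also forces size i = size a. *)
Definition compatible (a i : seq nat) : bool :=
  [&& all (leq 1) i, all2 leq i a
    & sorted (fun p q : nat * nat => (* p = (a_j, i_j), q = (a_{j+1}, i_{j+1}) *)
                (q.2 <= p.2)%N && ((q.1 < p.1) ==> (q.2 < p.2))%N) (zip a i)].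

(* Entries of i \in C(a) are at most max(a), so the sum is over all of C(a):   *)
(* see compatible_tuple.                                                       *)
Definition slide (a : seq nat) : Pol :=
  \sum_(i : (size a).-tuple 'I_(\max_(p <- a) p).+1
        | compatible a [seq val p | p <- i])
     \prod_(p <- [seq val p | p <- i]) x p.

Lemma bounded_tuple (b k : nat) (s : seq nat) :
  size s = k -> all (fun p => p <= b)%N s ->
  exists t : k.-tuple 'I_b.+1, [seq val p | p <- t] = s.
Proof.
move=> <- sb.
have sz : size [seq inord p : 'I_b.+1 | p <- s] == size s by rewrite size_map.
exists (Tuple sz) => /=; rewrite -map_comp; apply: map_id_in => p ps /=.
by rewrite inordK // ltnS (allP sb).
Qed.

Lemma compatible_tuple (a i : seq nat) :
  compatible a i ->
  exists t : (size a).-tuple 'I_(\max_(p <- a) p).+1, [seq val p | p <- t] = i.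
Proof.
case/and3P=> _ ia _; move: (ia); rewrite all2E => /andP[/eqP sz _].
apply: bounded_tuple => //; apply/(all_nthP 0%N) => j ji.
apply: (@leq_trans (nth 0%N a j)); last first.
  by apply: leq_bigmax_seq => //; rewrite mem_nth -?sz.
elim: i a ia j {sz} ji => [|p i IH] [|q a] //= /andP[pq ia] [|j] //= ji.
exact: IH.
Qed.

Lemma QSeq_tuple (n k : nat) (a : seq nat) :
  QSeq n a -> size a = k ->
  exists t : k.-tuple 'I_n.+1, [seq val p | p <- t] = a.
Proof.
case/and3P=> _ hd srt sz; apply: bounded_tuple => //.
case: a hd srt {sz} => [|p a] //= /eqP <-.
rewrite leqnn /=; elim: a p => [|q a IH] p //= /andP[pq /IH aq].
have qp : (q <= p)%N by case/orP: pq => /eqP ->.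
by rewrite qp; apply: sub_all aq => r /leq_trans; apply.
Qed.

Lemma divx_mul (i : nat) (h : Pol) : divx i (x i * h) = h.
Proof.
apply/malgP => m.
have mulI l m' : mmul (ucm i.-1) l = mmul (ucm i.-1) m' -> l = m'.
  move=> e; apply/eqP/cmP => j; move/eqP/cmP: e => /(_ j).
  by rewrite !cmM => /addnI.
have coefx m' : (x i * h)@_(mmul (ucm i.-1) m') = h@_m'.
  rewrite /x malgM_def fgmulUg raddf_sum /=.
  pose F (l : {cmonom nat}) : int := if l == m' then h@_l else 0.
  rewrite (eq_bigr F) => [|l _]; last first.
    by rewrite /F mcoeffU mul1r (inj_eq (mulI)); case: (l == m').
  have [m'h|m'h] := boolP (m' \in msupp h); last first.
    rewrite mcoeff_outdom // big1_seq // => l /andP[_ lh]; rewrite /F.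
    by case: eqP lh m'h => // -> ->.
  rewrite (bigD1_seq m' m'h (fset_uniq _)) /= {1}/F eqxx big1 ?addr0 //.
  by move=> l /negbTE lm; rewrite /F lm.
rewrite /divx raddf_sum /= big_mkcond.
pose F (m' : {cmonom nat}) : int :=
  if (0 < m' i.-1)%N && (divcm m' (ucm i.-1) == m) then (x i * h)@_m' else 0.
rewrite (eq_bigr F) => [|m' _]; last first.
  by rewrite /F mcoeffU; case: (0 < _)%N; case: (_ == m).
have dvK : divcm (mmul (ucm i.-1) m) (ucm i.-1) = m.
  by apply/eqP/cmP => j; rewrite divcmE cmM addKn.
have only (m' : {cmonom nat}) : (0 < m' i.-1)%N -> divcm m' (ucm i.-1) = m ->
    m' = mmul (ucm i.-1) m.
  move=> m'i <-; apply/eqP/cmP => j; rewrite cmM divcmE ucmE.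
  by case: eqP => [<-|_]; rewrite ?subnKC // add0n subn0.
have [ms|ms] := boolP (mmul (ucm i.-1) m \in msupp (x i * h)).
  rewrite (bigD1_seq (mmul (ucm i.-1) m)) //= ?fset_uniq //.
  rewrite {1}/F dvK eqxx cmM cmUU coefx big1_seq ?addr0 // => m' /andP[m'm _].
  rewrite /F; case: ifP => // /andP[m'i /eqP /(only _ m'i) e].
  by rewrite e eqxx in m'm.
rewrite -coefx mcoeff_outdom // big1_seq // => m' /andP[_ m's].
rewrite /F; case: ifP => // /andP[m'i /eqP /(only _ m'i) e].
by rewrite e (negbTE ms) in m's.
Qed.

Section CongruenceModulo.
Variables (A : comNzRingType) (y : A).

Definition congr_mod (p q : A) : Prop := exists h, p - q = y * h.

Lemma congr_mod_refl p : congr_mod p p.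
Proof. by exists 0; rewrite subrr mulr0. Qed.

Lemma congr_modD p q p' q' :
  congr_mod p q -> congr_mod p' q' -> congr_mod (p + p') (q + q').
Proof. by move=> [h e] [h' e']; exists (h + h'); rewrite mulrDr -e -e' opprD addrACA. Qed.

Lemma congr_modM p q p' q' :
  congr_mod p q -> congr_mod p' q' -> congr_mod (p * p') (q * q').
Proof.
move=> [h e] [h' e']; exists (h * p' + q * h').
by rewrite mulrDr [y * (q * _)]mulrCA -e' mulrA -e mulrBr mulrBl addrA subrK.
Qed.

Lemma congr_modX p q n : congr_mod p q -> congr_mod (p ^+ n) (q ^+ n).
Proof.
move=> pq; elim: n => [|n IH]; first exact: congr_mod_refl.
by rewrite !exprS; apply: congr_modM.
Qed.

Lemma congr_mod_y0 : congr_mod y 0.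
Proof. by exists 1; rewrite subr0 mulr1. Qed.

Lemma congr_mod_0y : congr_mod 0 y.
Proof. by exists (-1); rewrite sub0r mulrN1. Qed.

End CongruenceModulo.

(* This determines T i f, since divx i is left inverse to multiplication by    *)
(* x i (divx_mul).                                                             *)
Lemma mulx_T (i : nat) (f : Pol) :
  (0 < i)%N -> x i * T i f = R i.+1 f - R i f.
Proof.
move=> i0; suff [h e] : congr_mod (x i) (R i.+1 f) (R i f).
  by rewrite /T e divx_mul.
rewrite /R /subst /mmap.
apply: (big_ind2 (congr_mod (x i))); first exact: congr_mod_refl.
  by move=> *; apply: congr_modD.
move=> m _; apply: congr_modM; first exact: congr_mod_refl.
apply: (big_ind2 (congr_mod (x i))); first exact: congr_mod_refl.
  by move=> *; apply: congr_modM.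
move=> v _; apply: congr_modX.
rewrite ltnS eqSS; case: (ltngtP v.+1 i) => [vi|vi|->].
- exact: congr_mod_refl.
- case: eqP => [->|_]; [exact: congr_mod_0y | exact: congr_mod_refl].
- exact: congr_mod_y0.
Qed.

(* Main.v *)
Require Import Defs.
From HB Require Import structures.
From mathcomp Require Import all_boot all_algebra finmap.
From mathcomp.multinomials Require Import monalg.

(** The proof peels one variable at a time off f.  Telescoping the identities
    x_i T_i g = R_(i+1) g - R_i g for g in m variables gives
      g = x_1 T_1 g + ... + x_m T_m g + R_1 g.
    If g is quasisymmetric in x_1, ..., x_n, then R_1 g = ... = R_n g, so only
    the term i = n survives.  The polynomial T_n g need not be quasisymmetric,
    but R_1, ..., R_(n-1) still agree on it; in general, if g lives in m
    variables and R_1 g = ... = R_(m-1) g, then only T_m g and T_(m-1) g can be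
    nonzero, and T_p g has the same property with p for m (almost_stabilized_t).
    Iterating T on f therefore only meets the sequences of QSeq_n.

    On the other side, splitting C(a) according to whether i_1 = a_1 shows, for
    a = (y, s) with steps 0 or 1 downwards,
      F_a = x_y F_s + R_1 F_a    (gslide_cons):
    the tuples with i_1 < a_1 are exactly those obtained by lowering by one the
    entries of the tuples of C(a) without entry 1.

    Hence, by induction on the degree, both sides of the expansion solve the
    equation u = sum of x_p T_p g + R_1 u.  Their difference d satisfies
    d = R_1 d and has no constant term, so d = 0 (R1_fixed0): a nonconstant
    monomial of d would have all its shifts to the right in d as well.

    This argument only uses a few identities between R, T and the variables, so
    it is carried out over an arbitrary commutative ring with such operators
    (stabilized_expansion).  For polynomials these identities follow from the
    formula mcoeff_R for the coefficients of R_i f, which also translates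
    quasisymmetry into R_1 f = ... = R_n f (QSym_R). *)

Set Implicit Arguments.
Unset Strict Implicit.
Unset Printing Implicit Defensive.

Import GRing.Theory.

Local Open Scope ring_scope.

(** * Sums over tuples *)

Section BigTuple.
Variables (A : finType) (V : nmodType).

Lemma big_tuple0 (P : pred (seq A)) (F : seq A -> V) :
  \sum_(t : 0.-tuple A | P t) F t = if P [::] then F [::] else 0.
Proof.
rewrite big_mkcond (big_pred1 [tuple]) // => t.
by apply/esym/eqP; exact: tuple0.
Qed.

(** Both the tuples of a slide polynomial and the sequences of the expansion are
    enumerated by their first entry. *)
Lemma big_tuple_cons k (P : pred (seq A)) (F : seq A -> V) :
  \sum_(t : k.+1.-tuple A | P t) F t =
  \sum_(y : A) \sum_(t : k.-tuple A | P (y :: t)) F (y :: t).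
Proof.
rewrite pair_big_dep /=.
rewrite (reindex (fun p : A * k.-tuple A => [tuple of p.1 :: p.2])) //.
exists (fun t => (thead t, [tuple of behead t])) => [[y t]|t] _ /=.
  by congr (_, _); apply: val_inj.
by rewrite -tuple_eta.
Qed.

End BigTuple.

(** * Slide polynomials over a commutative ring *)

Definition step (p q : nat) : bool := (p == q) || (p == q.+1).

Definition vals (b : nat) (s : seq 'I_b) : seq nat := [seq val p | p <- s].

Section Slide.
Variables (A : comNzRingType) (X : nat -> A).

Definition gslide (a : seq nat) : A :=
  \sum_(i : (size a).-tuple 'I_(\max_(p <- a) p).+1 | compatible a (vals i))
     \prod_(p <- vals i) X p.

Definition wstep (p q : nat * nat) : bool :=
  (q.2 <= p.2)%N && ((q.1 < p.1) ==> (q.2 < p.2))%N.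

(** Generating function of the tails of compatible sequences: it sums over the
    sequences that may follow an index i placed in front of the bound p.  Unlike
    gslide, it can be defined by recursion on a. *)
Fixpoint wslide (p i : nat) (a : seq nat) : A :=
  if a is q :: a' then
    \sum_(1 <= j < (minn q (i - (q < p))).+1) X j * wslide q j a'
  else 1.

Lemma sum_tuples_wslide b p i a : all (leq^~ b) a ->
  \sum_(s : (size a).-tuple 'I_b.+1 |
      [&& all (leq 1) (vals s), all2 leq (vals s) a
        & path wstep (p, i) (zip a (vals s))])
    \prod_(j <- vals s) X j = wslide p i a.
Proof.
elim: a p i => [|q a IH] p i /=.
  move=> _; rewrite (big_tuple0 (fun s => [&& all (leq 1) (vals s),
    all2 leq (vals s) [::] & path wstep (p, i) (zip [::] (vals s))])
    (fun s => \prod_(j <- vals s) X j)) /=.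
  by rewrite big_nil.
case/andP=> qb ab.
rewrite (big_tuple_cons _ (fun s => [&& all (leq 1) (vals s),
    all2 leq (vals s) (q :: a) & path wstep (p, i) (zip (q :: a) (vals s))])
    (fun s => \prod_(j <- vals s) X j)) /=.
set M := minn q _.
have Mb : (M < b.+1)%N by rewrite ltnS (leq_trans (geq_minl _ _)).
rewrite (big_nat_widen _ _ b.+1) // (big_nat_widenl _ 0) //= big_mkord.
rewrite [RHS]big_mkcond; apply: eq_bigr => j _ /=.
have jM : (j < M.+1)%N && (0 < j)%N =
          [&& (0 < j)%N, (j <= q)%N & wstep (p, i) (q, val j)].
  rewrite ltnS /M leq_min /wstep /=.
  case: (val j) => [|j']; first by rewrite andbF.
  rewrite andbT /=; case: (j' < q)%N => //=.
  case: (q < p)%N => /=; last by rewrite subn0 andbT.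
  by case: i {IH M Mb} => [|i]; rewrite ?subn1 //= ltnS andbC andb_idr // => /leqW.
rewrite jM; case: ifP => [/and3P[j1 jq jw]|jF].
  rewrite -IH // mulr_sumr; apply: eq_big => s; first by rewrite j1 jq jw.
  by rewrite big_cons.
rewrite big_pred0 // => s; apply: contraFF jF.
by case/and3P=> /andP[-> _] /andP[-> _] /andP[-> _].
Qed.

Lemma gslideE p a : path step p a -> gslide a = wslide p p a.
Proof.
move=> pa; rewrite -(@sum_tuples_wslide (\max_(q <- a) q)); last first.
  by apply/allP => q qa; apply: leq_bigmax_seq.
apply: eq_bigl => s; rewrite /compatible; apply: andb_id2l => _.
apply: andb_id2l; rewrite -[sorted _ _]/(sorted wstep (zip a (vals s))).
case: a pa s => [|q a] /=; first by move=> _ s; case: (vals s).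
case/andP=> pq _ s; case: (vals s) => [|j v] //= /andP[jq _].
rewrite {2}/wstep /=.
suff -> : (j <= p)%N && ((q < p)%N ==> (j < p)%N) by [].
by case/orP: pq jq => /eqP -> jq; rewrite ?ltnn ?ltnS ?leqnn ?jq ?leqW.
Qed.

Lemma gslide0 : gslide [::] = 1.
Proof. exact: (@gslideE 0). Qed.

Variables (r : nat -> {rmorphism A -> A}).
Hypothesis rX : forall i j, (0 < j)%N ->
  r i (X j) = if (j < i)%N then X j else if j == i then 0 else X j.-1.

(** R_1 lowers every index by one and kills the tuples containing 1.  Lowering
    the initial index i by one has the same effect: as a descends by at most one
    at each step and i <= p, the bounds j <= q are consequences of the bounds
    coming from i, so nothing else prevents the shift. *)
Lemma r1_wslide p i a : path step p a -> (i <= p)%N ->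
  r 1 (wslide p i a) = wslide p i.-1 a.
Proof.
elim: a p i => [|q a IH] p i /=; first by rewrite rmorph1.
case/andP=> pq qa ip.
(* Along a step, the bound by q follows from the one inherited from k. *)
have M k : (k <= p)%N -> minn q (k - (q < p)) = (k - (q < p))%N.
  move=> kp; apply/minn_idPr; rewrite leq_subLR (leq_trans kp) //.
  by case/orP: pq => /eqP ->; rewrite ?ltnn ?ltnSn.
rewrite !M ?(leq_trans (leq_pred _)) // -predn_sub.
have : (i - (q < p) <= q)%N by rewrite -M // geq_minl.
case: (i - _)%N => [|k] kq; first by rewrite !big_geq // rmorph0.
rewrite rmorph_sum [LHS]big_nat_recl //= rmorphM rX //= mul0r add0r.
apply: eq_big_nat => j /andP[j0 jk].
by rewrite rmorphM rX //= eqSS gtn_eqF //= IH // (leq_trans _ kq).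
Qed.

(** The first summand collects the tuples with first index y, the second one
    those whose first index is smaller. *)
Lemma gslide_cons y a : (0 < y)%N -> path step y a ->
  gslide (y :: a) = X y * gslide a + r 1 (gslide (y :: a)).
Proof.
move=> y0 ya; have yya : path step y (y :: a) by rewrite /= /step eqxx.
rewrite (gslideE yya) (gslideE ya) r1_wslide //= ltnn !subn0 minnn.
by rewrite (minn_idPr (leq_pred y)) prednK // big_nat_recr //= addrC.
Qed.

(** * The expansion over a commutative ring *)

Variables (t : nat -> A -> A).
Hypothesis rC : forall i j f, (0 < i)%N -> (i <= j)%N ->
  r i (r j.+1 f) = r j (r i f).
Hypothesis Xt : forall i f, (0 < i)%N -> X i * t i f = r i.+1 f - r i f.
Hypothesis Xreg : forall i, (0 < i)%N -> GRing.lreg (X i).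

Definition almost_stabilized (m : nat) (f : A) : Prop :=
  (forall i, (m < i)%N -> r i f = f) /\
  (forall i, (0 < i)%N -> (i.+1 < m)%N -> r i.+1 f = r i f).

(** Multiply by the regular element X p (or X p.-1 once R_i is applied) and use
    the commutation of insertions: R_i R_(p+1) = R_p R_i turns an equality
    between R_i f and R_(i+1) f into one for T_p f. *)
Lemma almost_stabilized_t m p f :
  almost_stabilized m f -> (0 < p)%N -> step m p -> almost_stabilized p (t p f).
Proof.
move=> [fm fr] p0 mp.
have pm : (p <= m)%N by case/orP: mp => /eqP ->.
have mp1 : (m <= p.+1)%N by case/orP: mp => /eqP ->.
split=> i.
  move=> pi; have i0 := leq_trans p0 (ltnW pi).
  apply: (Xreg p0); rewrite Xt //.
  have <- : r i (X p) = X p by rewrite rX // pi.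
  rewrite -rmorphM Xt // rmorphB -(@rC p.+1 i) // -(@rC p i) ?(ltnW pi) //.
  by rewrite fm // ltnS (leq_trans mp1).
move=> i0 ip; have ip1 : (i.+1 <= p.-1)%N by rewrite -ltnS prednK.
have q0 : (0 < p.-1)%N by rewrite (leq_trans _ ip1).
have rp k : (0 < k)%N -> (k <= p.-1)%N ->
    X p.-1 * r k (t p f) = r p (r k f) - r p.-1 (r k f).
  move=> k0 kp; have kp' : (k < p)%N by rewrite -(prednK p0) ltnS.
  have <- : r k (X p) = X p.-1.
    by rewrite rX // ltnNge (ltnW kp') /= gtn_eqF.
  rewrite -rmorphM Xt // rmorphB rC // ?(ltnW kp') //; congr (_ - _).
  by rewrite -[in r p f](prednK p0) rC.
apply: (Xreg q0); rewrite !rp ?(ltnW ip1) // fr //.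
exact: leq_trans ip pm.
Qed.

Lemma t_eq0 i f : (0 < i)%N -> r i.+1 f = r i f -> t i f = 0.
Proof. by move=> i0 e; apply: (Xreg i0); rewrite Xt // e subrr mulr0. Qed.

(** In the sum of all X y * t y f, the telescoping makes the terms below m - 1
    vanish; the terms left are those reached by a step from m. *)
Lemma almost_stabilized_telescope n m f : (m <= n)%N -> almost_stabilized m f ->
  f = \sum_(y < n.+1 | step m y && (0 < y)%N) X y * t y f + r 1 f.
Proof.
move=> mn [fm fr].
suff -> : \sum_(y < n.+1 | step m y && (0 < y)%N) X y * t y f = f - r 1 f.
  by rewrite subrK.
transitivity (\sum_(1 <= y < m.+1) (r y.+1 f - r y f)); last first.
  by rewrite telescope_sumr // fm.
rewrite (big_nat_widen _ _ n.+1) ?ltnS // (big_nat_widenl _ 0) //= big_mkord.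
rewrite big_mkcond [RHS]big_mkcond; apply: eq_bigr => y _ /=.
have [y0|] := ltnP 0 y; last by rewrite !andbF.
rewrite !andbT; have [my|] := boolP (step m y).
  rewrite Xt // ltnS ifT //; by case/orP: my => /eqP ->.
rewrite /step negb_or => /andP[my my']; case: ifP => //; rewrite ltnS => ym.
rewrite fr ?subrr //.
by rewrite ltn_neqAle eq_sym my' ltn_neqAle eq_sym my.
Qed.

Variables (B : comNzRingType) (aug : {rmorphism A -> B}).
Hypothesis augX : forall i, aug (X i) = 0.
Hypothesis r1_fixed0 : forall f, r 1 f = f -> aug f = 0 -> f = 0.

(** The trace of homogeneity of degree k that survives in this generality: every
    word of length k in the t i maps f to a constant, and the shorter words map
    f to elements without constant term. *)
Fixpoint t_homogeneous (k : nat) (f : A) : Prop :=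
  if k is k'.+1 then aug f = 0 /\ forall i, (0 < i)%N -> t_homogeneous k' (t i f)
  else r 1 f = f.

Definition tseq (a : seq nat) (f : A) : A := foldl (fun g i => t i g) f a.

Lemma r1_tseq a f :
  all (leq 1) a -> t_homogeneous (size a) f -> r 1 (tseq a f) = tseq a f.
Proof. by elim: a f => //= i a IH f /andP[i0 a0] [_ /(_ i i0)]; apply: IH. Qed.

Lemma aug_gslide y a : path step y a -> aug (gslide (y :: a)) = 0.
Proof.
move=> ya; rewrite (@gslideE y) /= ?/step ?eqxx //.
by rewrite rmorph_sum big1 // => j _; rewrite rmorphM augX mul0r.
Qed.

(** Both sides are solutions u of u = \sum_y X y * t y f + r 1 u without constant
    term, and such a solution is unique; the induction hypothesis is applied to
    the t y f. *)
Lemma almost_stabilized_expansion n k m f :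
  (m <= n)%N -> almost_stabilized m f -> t_homogeneous k f ->
  f = \sum_(s : k.-tuple 'I_n.+1 | path step m (vals s) && all (leq 1) (vals s))
        tseq (vals s) f * gslide (vals s).
Proof.
elim: k m f => [|k IH] m f mn fm fk.
  rewrite (big_tuple0 (fun s => path step m (vals s) && all (leq 1) (vals s))
    (fun s => tseq (vals s) f * gslide (vals s))) /=.
  by rewrite gslide0 mulr1.
rewrite (big_tuple_cons _
  (fun s => path step m (vals s) && all (leq 1) (vals s))
  (fun s => tseq (vals s) f * gslide (vals s))) /=.
case: fk => f0 fk; set E := (RHS).
apply/eqP; rewrite -subr_eq0; apply/eqP/r1_fixed0; last first.
  rewrite rmorphB f0 rmorph_sum big1 ?subr0 // => y _.
  rewrite rmorph_sum big1 // => s /andP[/andP[_ ys] _].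
  by rewrite rmorphM aug_gslide // mulr0.
suff eE : E = \sum_(y < n.+1 | step m y && (0 < y)%N) X y * t y f + r 1 E.
  rewrite rmorphB; apply/esym.
  rewrite {1}(almost_stabilized_telescope mn fm) {1}eE.
  by rewrite opprD addrACA subrr add0r.
rewrite {1 2}/E rmorph_sum [X in _ = X + _]big_mkcond -big_split.
apply: eq_bigr => y _ /=; rewrite rmorph_sum.
case: ifP => [/andP[my y0]|ny]; last first.
  by rewrite !big_pred0 ?addr0 // => s;
    apply: contraFF ny => /andP[/andP[-> _] /andP[-> _]].
have yn : (y <= n)%N by rewrite -ltnS.
rewrite [Z in _ = _ * Z + _](IH y _ yn (almost_stabilized_t fm y0 my) (fk y y0)).
rewrite mulr_sumr.
under [X in _ = X + _]eq_bigl => s.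
  rewrite (_ : _ && _ = (step m y && path step y (vals s)) &&
    ((0 < y)%N && all (leq 1) (vals s))); last by rewrite my y0.
  over.
rewrite -big_split; apply: eq_bigr => s /andP[/andP[_ ys] /andP[_ s0]] /=.
rewrite [in LHS]gslide_cons // mulrDr rmorphM mulrCA; congr (_ + _ * _).
rewrite [RHS]r1_tseq //; last by rewrite size_map size_tuple; apply: fk.
Qed.

Definition stabilized (n : nat) (f : A) : Prop :=
  (forall i, (n < i)%N -> r i f = f) /\
  (forall i, (0 < i)%N -> (i < n)%N -> r i.+1 f = r i f).

Lemma tseq0 a : all (leq 1) a -> tseq a 0 = 0.
Proof. by elim: a => //= i a IH /andP[i0 a0]; rewrite t_eq0 ?rmorph0 ?IH. Qed.

(** The sequences starting with n - 1, which occur in the previous expansion but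
    not in QSeq n, contribute 0 because t n.-1 f = 0. *)
Lemma stabilized_expansion n k f : stabilized n f -> t_homogeneous k f ->
  f = \sum_(s : k.-tuple 'I_n.+1 | QSeq n (vals s))
        tseq (vals s) f * gslide (vals s).
Proof.
move=> [fn fr] fk.
have fs : almost_stabilized n f by split=> // i i0 /ltnW; apply: fr.
rewrite [LHS](almost_stabilized_expansion (leqnn n) fs fk).
rewrite big_mkcond [RHS]big_mkcond.
apply: eq_bigr => s _; rewrite /QSeq -[sorted _ _]/(sorted step (vals s)).
case: (vals s) => [|q a] //=.
rewrite /step [in n == q]eq_sym.
case: (q =P n) => [->|_] /=; first by rewrite andbC.
rewrite andbF; case: ifP => // /andP[/andP[/eqP nq _] /andP[q0 a0]].
by rewrite t_eq0 ?tseq0 ?mul0r // fr // nq.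
Qed.

End Slide.

(** * Monomials *)

Implicit Types (f g : Pol) (m : {cmonom nat}).

Lemma cm_eqP m1 m2 : (forall j, m1 j = m2 j) -> m1 = m2.
Proof. by move=> e; apply/eqP/cmP. Qed.

Lemma expcmnS m n : expcmn m n.+1 = mmul m (expcmn m n).
Proof.
case: n => [|n]; last by [].
by apply: cm_eqP => j; rewrite cmM onecmE addn0.
Qed.

Lemma expcmnE m n j : expcmn m n j = (n * m j)%N.
Proof.
elim: n => [|n IH]; first by rewrite onecmE mul0n.
by rewrite expcmnS cmM IH mulSn.
Qed.

Lemma mdeg_expcmn m n : mdeg (expcmn m n) = (n * mdeg m)%N.
Proof.
elim: n => [|n IH]; first exact: mdeg1.
by rewrite expcmnS mdegM IH mulSn.
Qed.

Lemma malgU_mul m1 m2 : << mmul m1 m2 >> = << m1 >> * << m2 >> :> Pol.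
Proof. by rewrite malgM_def fgmulUU mulr1. Qed.

Lemma malgU_exp m n : << expcmn m n >> = << m >> ^+ n :> Pol.
Proof.
elim: n => [|n IH]; first by rewrite expr0.
by rewrite expcmnS malgU_mul IH exprS.
Qed.

Lemma malgU_prod (I : Type) (r : seq I) (F : I -> {cmonom nat}) :
  << \big[mmul/mone]_(v <- r) F v >> = \prod_(v <- r) << F v >> :> Pol.
Proof. by elim/big_rec2: _ => // v m p _ <-; rewrite malgU_mul. Qed.

(** * Substitution is a ring morphism *)

Section Substitution.
Variable (s : nat -> Pol).

Definition eval_monom (m : {cmonom nat}) : Pol :=
  \prod_(v <- finsupp m) s v.+1 ^+ m v.

Lemma eval_monomEw (d : {fset nat}) m :
  (finsupp m `<=` d)%fset -> eval_monom m = \prod_(v <- d) s v.+1 ^+ m v.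
Proof.
move=> md; rewrite /eval_monom; apply: big_fset_incl => // v _.
by rewrite -cmE_eq0 => /eqP ->; rewrite expr0.
Qed.

Lemma eval_monom_mmorphism : mmorphism eval_monom.
Proof.
split=> [m1 m2|]; last by rewrite /eval_monom mdom1 big_seq_fset0.
pose d := (finsupp m1 `|` finsupp m2)%fset.
rewrite !(@eval_monomEw d) ?fsubsetUl ?fsubsetUr ?mdomD //.
by rewrite -big_split; apply: eq_bigr => v _; rewrite cmM exprD.
Qed.

HB.instance Definition _ :=
  isMultiplicative.Build _ _ eval_monom eval_monom_mmorphism.

Lemma substE : subst s = mmap (fun c : int => c%:MP) eval_monom.
Proof. by []. Qed.

Lemma eval_monomU i : eval_monom (ucm i) = s i.+1.
Proof. by rewrite /eval_monom mdomU big_seq_fset1 cmUU. Qed.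

Fact subst_is_additive : additive (subst s).
Proof. by rewrite substE; exact: raddfB. Qed.
HB.instance Definition _ := GRing.isAdditive.Build Pol Pol (subst s)
  subst_is_additive.

Fact subst_is_multiplicative : multiplicative (subst s).
Proof. by rewrite substE; exact: mmap_is_multiplicative. Qed.
HB.instance Definition _ := GRing.isMultiplicative.Build Pol Pol (subst s)
  subst_is_multiplicative.

Lemma subst_malgU (c : int) m : subst s << c *g m >> = c%:MP * eval_monom m.
Proof. by rewrite substE mmapU. Qed.

End Substitution.

HB.instance Definition _ i := GRing.RMorphism.copy (R i) (subst _).

Lemma R_x i j : (0 < j)%N ->
  R i (x j) = if (j < i)%N then x j else if j == i then 0 else x j.-1.
Proof.
case: j => // j _.
by rewrite /R [in subst _ (x _)]/x subst_malgU eval_monomU mul1r.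
Qed.

(** * The coefficients of R_i f *)

Definition relabel (h : nat -> nat) (m : {cmonom nat}) : {cmonom nat} :=
  \big[mmul/mone]_(v <- finsupp m) expcmn (ucm (h v)) (m v).

Lemma mdeg_relabel h m : mdeg (relabel h m) = mdeg m.
Proof.
rewrite mdeg_prod mdegE; apply: eq_bigr => v _.
by rewrite mdeg_expcmn mdegU muln1.
Qed.

Lemma relabelE h m j : relabel h m j = (\sum_(v <- finsupp m) m v * (h v == j))%N.
Proof.
rewrite /relabel; elim/big_rec2: _ => [|v n m' _ <-]; first exact: cm1.
by rewrite cmM expcmnE cmU.
Qed.

Lemma relabel_fiber1 h m j u :
  (forall v, v \in finsupp m -> (h v == j) = (v == u)) -> relabel h m j = m u.
Proof.
move=> hj; rewrite relabelE.
have [um|um] := boolP (u \in finsupp m); last first.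
  rewrite big1_seq; first by apply/esym/eqP; rewrite cmE_eq0.
  move=> v /= vm; rewrite hj //.
  by case: eqP vm um => [->|_ _ _]; rewrite ?muln0 // => ->.
rewrite (bigD1_seq u) //= hj // eqxx muln1 big1_seq ?addn0 //.
by move=> v /andP[vu vm]; rewrite hj // (negbTE vu) muln0.
Qed.

(** The 0-based variables from c on move up by one, which frees the variable c:
    this is the monomial that R c.+1 maps back to m. *)
Definition shift (c : nat) : {cmonom nat} -> {cmonom nat} := relabel (bump c).

Lemma shiftE c m j : shift c m j = if j == c then 0%N else m (unbump c j).
Proof.
case: eqP => [->|/eqP jc].
  rewrite /shift relabelE big1 // => v _.
  by rewrite eq_sym (negbTE (neq_bump c v)) muln0.
apply: relabel_fiber1 => v _; apply/eqP/eqP => [<-|->]; first by rewrite bumpK.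
by rewrite unbumpK.
Qed.

(** The substitution defining R c. *)
Definition omit (c : nat) (j : nat) : Pol :=
  if (j < c)%N then x j else if j == c then 0 else x j.-1.

Lemma omitE c v : v != c -> omit c.+1 v.+1 = << ucm (unbump c v) >>.
Proof.
move=> vc; rewrite /omit ltnS eqSS (negbTE vc) /x /unbump.
have [vc'|vc'] := ltnP v c.
  by rewrite ltnNge (ltnW vc') subn0.
by rewrite ltn_neqAle eq_sym vc vc' subn1.
Qed.

(** R c.+1 kills the monomials containing the variable c and is a bijection from
    the others to all monomials, with inverse shift c. *)
Lemma mcoeff_eval_omit c m m' :
  (eval_monom (omit c.+1) m)@_m' = (m == shift c m')%:R.
Proof.
have [cm|cm] := boolP (c \in finsupp m).
  rewrite /eval_monom (bigD1_seq c) ?fset_uniq //= {1}/omit ltnn eqxx expr0n.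
  rewrite (negbTE (_ : m c != 0)%N) ?cmE_neq0 // mul0r mcoeff0.
  case: eqP => // e; move: cm; rewrite -cmE_neq0 e shiftE eqxx.
  by [].
have -> : eval_monom (omit c.+1) m = << relabel (unbump c) m >>.
  rewrite malgU_prod; apply: eq_big_seq => v vm.
  by rewrite malgU_exp omitE //; apply: contraNneq cm => <-.
have down j : relabel (unbump c) m j = m (bump c j).
  apply: relabel_fiber1 => v vm.
  have vc : v != c by apply: contraNneq cm => <-.
  by apply/eqP/eqP => [<-|->]; rewrite ?unbumpK ?bumpK.
rewrite mcoeffU1; congr (_%:R); congr nat_of_bool.
apply/eqP/eqP => [<-|e]; apply: cm_eqP => j.
  rewrite shiftE; case: eqP => [->|/eqP jc].
    by apply/eqP; rewrite cmE_eq0.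
  by rewrite down unbumpK.
by rewrite down e shiftE eq_sym (negbTE (neq_bump c j)) bumpK.
Qed.

Lemma mcoeff_R c f m : (R c.+1 f)@_m = f@_(shift c m).
Proof.
rewrite /R -[fun j => _]/(omit c.+1) substE mmapE raddf_sum /=.
under eq_bigr => m' _ do rewrite mcoeffCM mcoeff_eval_omit.
have [ms|ms] := boolP (shift c m \in msupp f).
  rewrite (bigD1_seq (shift c m)) ?fset_uniq //= eqxx mulr1.
  by rewrite big1 ?addr0 // => m' /negbTE ->; rewrite mulr0.
rewrite mcoeff_outdom // big1_seq // => m' /= m's.
by case: eqP m's ms => [-> ->|]; rewrite ?mulr0.
Qed.

Lemma shift_at c m : shift c m c = 0%N.
Proof. by rewrite shiftE eqxx. Qed.

Lemma shift_below c m j : (j < c)%N -> shift c m j = m j.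
Proof.
by move=> jc; rewrite shiftE (ltn_eqF jc) /unbump ltnNge (ltnW jc) subn0.
Qed.

Lemma shift_above c m j : (c <= j)%N -> shift c m j.+1 = m j.
Proof. by move=> cj; rewrite shiftE gtn_eqF // /unbump ltnS cj subn1. Qed.

Lemma shift_comm i j m :
  (i <= j)%N -> shift j.+1 (shift i m) = shift i (shift j m).
Proof.
move=> ij; apply: cm_eqP => v.
have [vi|iv|->] := ltngtP v i.
- have vj := leq_trans vi ij.
  by rewrite !shift_below // leqW.
- case: v iv => // v; rewrite ltnS => iv; rewrite (shift_above _ iv).
  have [vj|jv|->] := ltngtP v j; last by rewrite !shift_at.
    by rewrite shift_below // shift_above // shift_below.
  case: v iv jv => // v _ jv.
  by rewrite !shift_above // (leq_trans ij).
- by rewrite shift_at shift_below // shift_at.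
Qed.

Lemma Pol_eqP f g : (forall m, f@_m = g@_m) -> f = g.
Proof. by move=> fg; apply/malgP => m; exact: fg. Qed.

Lemma R_comm i j f : (0 < i)%N -> (i <= j)%N -> R i (R j.+1 f) = R j (R i f).
Proof.
move=> i0 ij; have j0 := leq_trans i0 ij.
rewrite -(prednK i0) -(prednK j0); apply: Pol_eqP => m.
have ij' : (i.-1 <= j.-1)%N by rewrite -ltnS !prednK.
apply: etrans (etrans (mcoeff_R _ _ _) (mcoeff_R _ _ _)) _.
apply: etrans _ (esym (etrans (mcoeff_R _ _ _) (mcoeff_R _ _ _))).
by rewrite shift_comm.
Qed.

Lemma x_lreg i : GRing.lreg (x i).
Proof.
move=> f g fg.
exact: etrans (esym (divx_mul i f)) (etrans (congr1 (divx i) fg) (divx_mul i g)).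
Qed.

Lemma mcoeff_out n f m v :
  inPol n f -> (n <= v)%N -> v \in finsupp m -> f@_m = 0.
Proof.
rewrite -cmE_neq0 => fn nv mv; apply: mcoeff_outdom.
by apply: contra mv => /fn /(_ v.+1 nv) /= ->.
Qed.

Lemma R_id n c f : inPol n f -> (n <= c)%N -> R c.+1 f = f.
Proof.
move=> fn nc; apply: Pol_eqP => m; apply: etrans (mcoeff_R _ _ _) _.
have [/hasP[v vm cv]|/hasPn mc] := boolP (has (leq c) (finsupp m)).
  have nv := leq_trans nc cv.
  rewrite (mcoeff_out fn nv vm) (mcoeff_out fn (leqW nv)) //.
  by rewrite -cmE_neq0 shift_above // cmE_neq0.
have m0 v : (c <= v)%N -> m v = 0%N.
  by move=> cv; apply/eqP; rewrite cmE_eq0; apply/negP => /mc; rewrite cv.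
congr (f@_ _); apply: cm_eqP => v.
have [vc|cv|->] := ltngtP v c; first by rewrite shift_below.
  by case: v cv => // v cv; rewrite shift_above // !m0 // ltnW.
by rewrite shift_at m0.
Qed.

(** Such an f has equal coefficients at m and at all the shifts of m.  If m is not
    1, these shifts involve arbitrarily high variables, hence leave the finite
    support of f. *)
Lemma R1_fixed0 f : R 1 f = f -> f@_mone = 0 -> f = 0.
Proof.
move=> fR f1; apply: Pol_eqP => m; rewrite mcoeff0.
have [->//|m1] := eqVneq m mone.
have [v vm] : exists v, v \in finsupp m.
  case: (fset_0Vmem (finsupp m)) => [m0|[v vm]]; last by exists v.
  case/eqP: m1; apply: cm_eqP => j.
  by rewrite cm1; apply/eqP; rewrite cmE_eq0 m0 inE.
pose b := \max_(m <- msupp f) \max_(u <- finsupp m) u.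
have coefN N : f@_m = f@_(iter N (shift 0) m).
  elim: N => // N ->; rewrite iterS.
  exact: etrans (congr1 (fun g : Pol => g@_(iter N (shift 0) m)) (esym fR))
    (mcoeff_R _ _ _).
have varN N : iter N (shift 0) m (N + v)%N = m v.
  by elim: N => // N <-; rewrite iterS addSn shift_above.
rewrite (coefN b.+1); apply: mcoeff_outdom; apply/negP => mf.
suff : (b.+1 + v <= b)%N by rewrite addSn ltnNge leq_addr.
apply: leq_trans (leq_bigmax_seq _ mf _) => //.
apply: (@leq_bigmax_seq _ _ xpredT (fun u : nat => u)) => //.
by rewrite -cmE_neq0 varN cmE_neq0.
Qed.

(** * Homogeneity *)

Lemma homogeneousP k f :
  homogeneous k f <-> (forall m, mdeg m != k -> f@_m = 0).
Proof.
split=> fk m.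
  by move=> mk; apply: mcoeff_outdom; apply: contra mk => /fk/eqP.
by rewrite -mcoeff_neq0 => fm; apply/eqP; apply: contraNT fm => /fk ->.
Qed.

Lemma homogeneous_R k i f : (0 < i)%N -> homogeneous k f -> homogeneous k (R i f).
Proof.
move=> i0 /homogeneousP fk; rewrite -(prednK i0); apply/homogeneousP => m mk.
by apply: etrans (mcoeff_R _ _ _) _; apply: fk; rewrite mdeg_relabel.
Qed.

Lemma homogeneousB k f g :
  homogeneous k f -> homogeneous k g -> homogeneous k (f - g).
Proof.
move=> /homogeneousP fk /homogeneousP gk; apply/homogeneousP => m mk.
by rewrite mcoeffB fk // gk // subr0.
Qed.

Lemma homogeneous_divx k i f : homogeneous k.+1 f -> homogeneous k (divx i f).
Proof.
move=> fk; apply/homogeneousP => m mk; rewrite /divx raddf_sum /=.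
rewrite big_seq_cond big1 // => m' /andP[m'f m'i]; rewrite mcoeffU.
have [e|_] := eqVneq (divcm m' (ucm i.-1)) m; last by rewrite mulr0n.
case/eqP: mk; apply: succn_inj.
rewrite -(fk _ m'f) -e -addn1 -(mdegU i.-1) -mdegM.
congr mdeg; apply: cm_eqP => j; rewrite cmM divcmE cmU subnK //.
by case: eqP => // <-.
Qed.

Lemma homogeneous_T k i f :
  (0 < i)%N -> homogeneous k.+1 f -> homogeneous k (T i f).
Proof.
move=> i0 fk.
by apply: homogeneous_divx; apply: homogeneousB; apply: homogeneous_R.
Qed.

Lemma homogeneous0_R1 f : homogeneous 0 f -> R 1 f = f.
Proof.
move=> /homogeneousP f0; apply: Pol_eqP => m; apply: etrans (mcoeff_R _ _ _) _.
have [->|m1] := eqVneq m mone; last by rewrite !f0 ?mdeg_relabel ?mdeg_eq0.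
by congr (f@_ _); apply: cm_eqP => j; rewrite shiftE !cm1 if_same.
Qed.

Definition constant_term : {rmorphism Pol -> int} :=
  @mcoeff {cmonom nat} int mone.

Definition Rmorph (i : nat) : {rmorphism Pol -> Pol} := R i.

Lemma homogeneous_t_homogeneous k f :
  homogeneous k f -> t_homogeneous Rmorph T constant_term k f.
Proof.
elim: k f => [|k IH] f fk /=; first exact: homogeneous0_R1.
split=> [|i i0]; last by apply: IH; apply: homogeneous_T.
by move/homogeneousP: fk; apply; rewrite mdeg1.
Qed.

(** * Quasisymmetry *)

Lemma shift_mon c m :
  shift c m = mon [seq (bump c v).+1 | v <- sort leq (finsupp m)]
                  [seq m v | v <- sort leq (finsupp m)].
Proof.
rewrite /mon zip_map big_map /shift /relabel; apply: perm_big.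
by rewrite perm_sym perm_sort.
Qed.

Lemma incr_in_shift c n m :
  (forall v, v \in finsupp m -> bump c v < n)%N ->
  incr_in n [seq (bump c v).+1 | v <- sort leq (finsupp m)].
Proof.
move=> mn; apply/andP; split; last first.
  by apply/allP => p /mapP[v]; rewrite mem_sort => /mn vn ->.
rewrite sorted_map; have := sort_sorted leq_total (finsupp m).
rewrite [sorted leq _](_ : _ = sorted ltn (sort leq (finsupp m))); last first.
  by rewrite ltn_sorted_uniq_leq sort_uniq fset_uniq.
by apply: sub_sorted => u v /=; rewrite ltnS !ltnNge leq_bump2.
Qed.

(** The coefficients of a monomial m in both sides are those of f at shift c.+1 m
    and shift c m, which have the same sequence of nonzero exponents. *)
Lemma QSym_R n c f : inQSym n f -> (c.+1 < n)%N -> R c.+2 f = R c.+1 f.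
Proof.
move=> [fn fq] cn; apply: Pol_eqP => m.
apply: etrans (mcoeff_R _ _ _) _; apply: etrans _ (esym (mcoeff_R _ _ _)).
(* Either both shifts involve a variable outside x_1, ..., x_n, or both are
   monomials in x_1, ..., x_n and quasisymmetry applies. *)
have [/hasP[v vm nv]|/hasPn mn] := boolP (has (fun v => n <= v.+1)%N (finsupp m)).
  have cv : (c < v)%N by rewrite -ltnS (leq_trans cn).
  have out d : (d <= v)%N -> f@_(shift d m) = 0.
    by move=> dv; rewrite (mcoeff_out fn nv) // -cmE_neq0 shift_above ?cmE_neq0.
  by rewrite (out _ cv) (out _ (ltnW cv)).
have mn' d v : (v \in finsupp m -> bump d v < n)%N.
  move=> /mn; rewrite -ltnNge; apply: leq_ltn_trans.
  by rewrite /bump -add1n leq_add2r leq_b1.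
rewrite !shift_mon; apply: fq; rewrite ?size_map //;
  try exact: incr_in_shift (mn' _).
by apply/allP => _ /mapP[v + ->]; rewrite mem_sort -cmE_neq0 lt0n.
Qed.

Theorem corollary8p6 (n k : nat) (f : Pol) :
  inQSym n f -> homogeneous k f ->
  f = \sum_(a : k.-tuple 'I_n.+1 | QSeq n [seq val p | p <- a])
        Tseq [seq val p | p <- a] f * slide [seq val p | p <- a].
Proof.
move=> fq fk.
have fs : stabilized Rmorph n f.
  split=> [i ni|i i0 ni].
    have i0 := leq_ltn_trans (leq0n n) ni.
    have nc : (n <= i.-1)%N by rewrite -ltnS prednK.
    have := R_id fq.1 nc; rewrite (prednK i0); exact.
  have cn : (i.-1.+1 < n)%N by rewrite prednK.
  have := QSym_R fq cn; rewrite (prednK i0); exact.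
have aug_x i : constant_term (x i) = 0 by rewrite /= mcoeffU1 cm1_eq1.
exact: (@stabilized_expansion Pol x Rmorph R_x T R_comm mulx_T
  (fun i _ => @x_lreg i) _ _ aug_x R1_fixed0 n k f fs
  (homogeneous_t_homogeneous fk)).
Qed.
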